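(* Suppose that $k,r\in\mathbb{N}$ satisfy $r\le k$ and $(k-r)(k-r+1)<2k-2$. Fix coefficients $a_{jl}\in\mathbb{Z}$ for $1\le l\le k-r$ and $k-r+1\le j\le k$. Let $M_{k,r}(X;\mathbf{a})$ be the number of integral solutions of the simultaneous equations \[ \sigma_j(\mathbf{x})+\sum_{l=1}^{k-r}a_{jl}\sigma_l(\mathbf{x})=\sigma_j(\mathbf{y})+\sum_{l=1}^{k-r}a_{jl}\sigma_l(\mathbf{y})\quad(k-r+1\le j\le k) \] in variables $\mathbf{x}=(x_1,\ldots,x_k)$ and $\mathbf{y}=(y_1,\ldots,y_k)$ with $1\le x_i,y_i\le X$ $(1\le i\le k)$. Then there is a paucity of non-diagonal solutions in this system, that is, $M_{k,r}(X;\mathbf{a})=T_k(X)+o(T_k(X))$ as $X\to\infty$. In particular, for each $\varepsilon>0$ one has \[ M_{k,r}(X;\mathbf{a})=T_k(X)+O\bigl(X^{\frac12(k-r)(k-r+1)+1+\varepsilon}\bigr). \]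
   Context: The elementary symmetric polynomials $\sigma_j(\mathbf{z})\in\mathbb{Z}[z_1,\ldots,z_k]$ $(0\le j\le k)$ are defined by $\sum_{j=0}^k\sigma_j(\mathbf{z})t^{k-j}=\prod_{i=1}^k(t+z_i)$. $T_k(X)$ denotes the number of pairs $(\mathbf{x},\mathbf{y})$ of integral $k$-tuples with $1\le x_i,y_i\le X$ $(1\le i\le k)$ for which there is a permutation $\pi$ of $\{1,\ldots,k\}$ with $y_i=x_{\pi i}$ $(1\le i\le k)$ (the trivial, or diagonal, solutions). $X$ is a sufficiently large positive number, and implicit constants in the $O$-notation may depend on $\varepsilon$, $k$ and the coefficients $a_{jl}$. *)

(* Defs.v *)
From HB Require Import structures.
From mathcomp Require Import all_boot all_order all_algebra all_fingroup.
From mathcomp Require Import all_classical all_reals all_analysis.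
From mathcomp Require mpoly.
(* The notations of mpoly clash with those of analysis. *)
Import (canonicals) mpoly.
Set Implicit Arguments.
Unset Strict Implicit.
Unset Printing Implicit Defensive.
Import Order.TTheory GRing.Theory Num.Theory.
Import numFieldNormedType.Exports.
Local Open Scope ring_scope.

Definition sigma (k j : nat) (z : 'I_k -> int) : int :=
  mpoly.meval z (mpoly.mesym k int j).

Lemma sigma_gen (k : nat) (z : 'I_k -> int) :
  \sum_(j < k.+1) (sigma j z)%:P * 'X^(k - j) =
  \prod_(i < k) ('X + (z i)%:P) :> {poly int}.
Proof.
under [RHS]eq_bigr do rewrite addrC.
rewrite bigA_distr.
rewrite (partition_big (fun A : {set 'I_k} => inord #|A| : 'I_k.+1) predT) //=.
apply: eq_bigr => j _.
rewrite /sigma mpoly.mesymE (raddf_sum (mpoly.meval z)) /=.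
rewrite (raddf_sum (@polyC int)) big_distrl /=.
apply: eq_big => [A|A /eqP cA].
  by rewrite -val_eqE /= inordK // ltnS -[leqRHS]card_ord max_card.
rewrite (bigID (mem A)) /=.
rewrite (eq_bigr (fun i => (z i)%:P)); last by move=> i ->.
rewrite [X in _ = _ * X](eq_bigr (fun=> 'X)); last by move=> i /negbTE ->.
congr (_ * _); last first.
  by rewrite prodr_const -cA; congr ('X^_); have := cardC A; rewrite card_ord => /esym {1}->; rewrite addKn.
rewrite mpoly.mevalX rmorph_prod /= [RHS]big_mkcond /=.
apply: eq_bigr => i _.
by rewrite mpoly.mnmE; case: (i \in A); rewrite ?expr1 ?expr0.
Qed.

(* The Landau notations infer a filter_on structure for their filter. *)
Canonical pinfty_filter_on (R : numFieldType) :=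
  FilterType (pinfty_nbhs R) _.

(* Since the entries are naturals, the integral k-tuples with 1 <= x_i <= X
   are the x : {ffun 'I_k -> 'I_(Num.truncn X).+1} with 1 <= x i for all i. *)
Section Counting.
Variables (R : realType) (k : nat).

Definition in_box (X : R) (x : {ffun 'I_k -> 'I_(Num.truncn X).+1}) : bool :=
  [forall i, (1 <= x i)%N].

Definition Tk (X : R) : nat :=
  #|[set xy : {ffun 'I_k -> 'I_(Num.truncn X).+1} *
              {ffun 'I_k -> 'I_(Num.truncn X).+1} |
      [&& in_box xy.1, in_box xy.2 &
          [exists p : 'S_k, [forall i, xy.2 i == xy.1 (p i)]]]]|.

Definition form (r : nat) (a : nat -> nat -> int) (j : nat)
    (z : 'I_k -> int) : int :=
  sigma j z + \sum_(1 <= l < (k - r).+1) a j l * sigma l z.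

Definition Mkr (r : nat) (a : nat -> nat -> int) (X : R) : nat :=
  #|[set xy : {ffun 'I_k -> 'I_(Num.truncn X).+1} *
              {ffun 'I_k -> 'I_(Num.truncn X).+1} |
      [&& in_box xy.1, in_box xy.2 &
          [forall j : 'I_k.+1, (k - r + 1 <= j)%N ==>
             (form r a j (fun i => (xy.1 i : nat)%:Z) ==
              form r a j (fun i => (xy.2 i : nat)%:Z))]]]|.

End Counting.

(* Main.v *)
Require Import Defs.
From HB Require Import structures.
From mathcomp Require Import all_boot all_order all_algebra all_fingroup.
From mathcomp Require Import all_classical all_reals all_analysis.
From mathcomp Require Import zify lra.
From mathcomp Require mpoly.
Import (canonicals) mpoly.
Import Order.TTheory GRing.Theory Num.Theory.
Import numFieldNormedType.Exports.
Local Open Scope ring_scope.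

(** Put d = k - r, D = d (d + 1) / 2 and let N be the integer part of X. Attach to
a point x of the box the polynomial P_x(t) = prod_i (t + x_i), whose
coefficients are the sigma_j(x). By
unique factorization, x and y are permutations of each other exactly when
P_x = P_y, so the diagonal pairs are solutions and the non-diagonal ones are
those for which tau = P_x - P_y is nonzero ([shift_poly_perm]).

The equations of the system express sigma_j(x) - sigma_j(y), for j > d, in terms
of the differences of index 1, .., d. Hence tau is determined by these d
integers ([solves_shift_poly_diff]), and as the l-th of them is O(N^l) for
entries at most N, only O(N^D) polynomials tau occur ([card_nondiag]).

It remains to bound the number of pairs giving a fixed nonzero tau
([card_shift_poly_diff]). Evaluation at -y_i gives
tau(-y_i) = prod_j (x_j - y_i). If this is nonzero for some i, choose i and y_i,
in O(N) ways; every x_j - y_i is then a divisor of a nonzero integer of size at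
most N^k, so that x is restricted to N^o(1) values by the divisor bound
([size_divisors_expn_le]); finally P_y = P_x - tau determines y up to order.
Otherwise all the -y_i are roots of tau, which leaves at most k^k choices of y,
and P_x = P_y + tau determines x up to order.

Altogether there are O(N^(D + 1 + eps)) non-diagonal solutions. This proves the
second estimate, and the first follows, because the hypothesis on k and r says
that D + 1 <= k - 1, whereas there are at least N^k diagonal solutions. *)

(** * The divisor bound *)

Lemma size_divisors_pfactor (p a q : nat) : prime p -> (0 < q)%N -> coprime p q ->
  (size (divisors (p ^ a * q)) <= a.+1 * size (divisors q))%N.
Proof.
move=> p_pr q_gt0 co_pq.
have n_gt0 : (0 < p ^ a * q)%N by rewrite muln_gt0 expn_gt0 prime_gt0.
rewrite -{1}(size_iota 0 a.+1) -(size_allpairs (fun i e => (p ^ i * e)%N)).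
apply: uniq_leq_size (divisors_uniq _) _ => e.
rewrite -dvdn_divisors // => dv_e.
have e_gt0 := dvdn_gt0 n_gt0 dv_e.
have [e' co_pe' def_e] := pfactor_coprime p_pr e_gt0.
apply/allpairsP; exists (logn p e, e').
rewrite mulnC -def_e -dvdn_divisors // [_.1]/= [_.2]/= mem_iota; split=> //.
  rewrite add0n /= ltnS -(pfactorK a p_pr) -[X in (_ <= X)%N]addn0.
  rewrite -(logn_coprime co_pq)
    -lognM // ?expn_gt0 ?(prime_gt0 p_pr) //.
  exact: dvdn_leq_log.
rewrite -(@Gauss_dvdr e' (p ^ a)) 1?coprime_sym ?coprimeXl //.
by apply: dvdn_trans dv_e; rewrite [X in (_ %| X)%N]def_e dvdn_mulr.
Qed.

(** Up to the factor m, a.+1 is at most a %/ m + 1, hence at most 2 ^ (a %/ m). *)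
Lemma succ_expn_le (m a : nat) : (0 < m)%N -> (a.+1 ^ m <= m ^ m * 2 ^ a)%N.
Proof.
move=> m_gt0; apply: (@leq_trans ((2 ^ (a %/ m) * m) ^ m)).
  rewrite leq_exp2r //; apply: leq_trans (ltn_ceil a m_gt0) _.
  by rewrite leq_mul2r ltn_expl // orbT.
by rewrite expnMn -expnM mulnC leq_mul2l leq_exp2l // leq_divM orbT.
Qed.

(** The divisor bound: for every exponent m, the m-th power of the number of
divisors of n is O(n). A prime power p ^ a contributes to it the factor
a.+1 ^ m; this is at most p ^ a when p >= 2 ^ m, and each of the fewer than
2 ^ m smaller primes loses at most a factor m ^ m by [succ_expn_le]. *)
Lemma size_divisors_expn_le (m n : nat) : (0 < m)%N -> (0 < n)%N ->
  (size (divisors n) ^ m <= (m ^ m) ^ (2 ^ m) * n)%N.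
Proof.
move=> m_gt0 n_gt0.
pose c := (m ^ m)%N; have c_gt0 : (0 < c)%N by rewrite expn_gt0 m_gt0.
(* Splitting off the least prime at each step, the exponent of c only has to pay
   for the primes between the current lower bound s and 2 ^ m. *)
suff gen s : (forall q, prime q -> q %| n -> s <= q)%N ->
    (size (divisors n) ^ m <= c ^ (2 ^ m - s) * n)%N.
  by have := gen 0%N; rewrite subn0; apply.
elim/ltn_ind: n n_gt0 s => n IHn n_gt0 s s_le.
have [n_le1 | n_gt1] := leqP n 1.
  have -> : n = 1%N by apply/eqP; rewrite eqn_leq n_le1.
  by rewrite muln1 exp1n expn_gt0 c_gt0.
have p_pr := pdiv_prime n_gt1; set p := pdiv n in p_pr.
have [q co_pq def_n] := pfactor_coprime p_pr n_gt0.
set a := logn p n in def_n.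
have a_gt0 : (0 < a)%N by rewrite logn_gt0 mem_primes p_pr n_gt0 pdiv_dvd.
have q_gt0 : (0 < q)%N by move: n_gt0; rewrite def_n muln_gt0 => /andP[].
have q_lt_n : (q < n)%N.
  by rewrite def_n ltn_Pmulr // -(exp1n a) ltn_exp2r ?prime_gt1.
have dv_qn : (q %| n)%N by rewrite def_n dvdn_mulr.
have p_lt r : prime r -> (r %| q)%N -> (p < r)%N.
  move=> r_pr r_dvd; rewrite ltn_neqAle pdiv_min_dvd ?prime_gt1 //; last first.
    exact: dvdn_trans r_dvd dv_qn.
  rewrite andbT; apply/negP => /eqP eq_pr; move: co_pq.
  by rewrite eq_pr prime_coprime // r_dvd.
have := IHn q q_lt_n q_gt0 p.+1 p_lt; set Q := size _ => IHq.
have sp : (s <= p)%N := s_le _ p_pr (pdiv_dvd n).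
have le_n : (size (divisors n) ^ m <= a.+1 ^ m * Q ^ m)%N.
  rewrite -expnMn leq_exp2r // [X in divisors X]def_n mulnC.
  exact: size_divisors_pfactor.
apply: leq_trans le_n _; rewrite [X in (_ <= _ * X)%N]def_n [(q * _)%N]mulnC.
have [p_big | p_small] := leqP (2 ^ m) p.
  apply: (@leq_trans (p ^ a * (c ^ (2 ^ m - p.+1) * q))).
    apply: leq_mul => //; apply: (@leq_trans ((2 ^ m) ^ a)).
      by rewrite -expnM mulnC expnM leq_exp2r // ltn_expl.
    by rewrite leq_exp2r.
  rewrite mulnCA leq_mul2r leq_pexp2l ?orbT //.
  by apply: leq_sub2l; apply: leqW.
apply: (@leq_trans ((c * p ^ a) * (c ^ (2 ^ m - p.+1) * q))).
  apply: leq_mul => //; apply: leq_trans (succ_expn_le m a m_gt0) _.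
  by rewrite leq_mul2l leq_exp2r // prime_gt1 // orbT.
rewrite mulnACA -expnS leq_mul2r leq_pexp2l ?orbT //.
by rewrite subnSK // leq_sub2l.
Qed.

(** * Pairs of points with a given polynomial difference *)

Lemma card_le_fibers (T U : finType) (S : {pred T}) (f : T -> U)
    (V : {pred U}) (n : nat) :
  {in S, forall s, f s \in V} ->
  (forall u, u \in V -> (#|[pred s in S | f s == u]| <= n)%N) ->
  (#|S| <= #|V| * n)%N.
Proof.
move=> f_in fib; rewrite -sum1_card (partition_big f (mem V)) //=.
rewrite -sum_nat_const; apply: leq_sum => u Vu.
by rewrite sum1_card; exact: fib.
Qed.

(** Once f s has been chosen in V, the injectivity leaves for s only the choice of
g s in Z (f s). It will be used with the two projections, in either order. *)
Lemma card_le_pairs (T U W : finType) (S : {pred T}) (f : T -> U) (g : T -> W)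
    (V : {pred U}) (Z : U -> {pred W}) (n : nat) :
  injective (fun s => (f s, g s)) ->
  {in S, forall s, f s \in V} -> {in S, forall s, g s \in Z (f s)} ->
  (forall u, u \in V -> (#|Z u| <= n)%N) ->
  (#|S| <= #|V| * n)%N.
Proof.
move=> fg_inj f_in g_in Z_le; apply: card_le_fibers f_in _ => u Vu.
apply: leq_trans (Z_le u Vu).
rewrite -(@fintype.card_in_image _ _ g) => [|s s' /andP[_ /eqP fs] /andP[_ /eqP fs'] gs].
  apply/subset_leq_card/fintype.subsetP => _ /fintype.imageP[s /andP[Ss /eqP <-] ->].
  exact: g_in.
by apply: fg_inj; rewrite fs fs' gs.
Qed.

Definition shift_poly {k N : nat} (x : {ffun 'I_k -> 'I_N.+1}) : {poly int} :=
  \prod_(i < k) ('X + ((x i : nat)%:Z)%:P).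

Section Box.
Variables k N : nat.
Notation box := {ffun 'I_k -> 'I_N.+1}.
Implicit Types (x y : box) (tau : {poly int}).

Lemma shift_polyE x : shift_poly x = \prod_(i < k) ('X - (- (x i : nat)%:Z)%:P).
Proof. by apply: eq_bigr => i _; rewrite polyCN opprK. Qed.

Lemma size_shift_poly x : size (shift_poly x) = k.+1.
Proof. by rewrite shift_polyE -big_enum size_prod_XsubC size_enum_ord. Qed.

Lemma horner_shift_poly x (c : int) :
  (shift_poly x).[- c] = \prod_(i < k) ((x i : nat)%:Z - c).
Proof.
by rewrite horner_prod; apply: eq_bigr => i _; rewrite !hornerE addrC.
Qed.

Lemma root_shift_poly x i : root (shift_poly x) (- (x i : nat)%:Z).
Proof. by rewrite rootE horner_shift_poly (bigD1 i) //= subrr mul0r. Qed.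

Lemma shift_poly_perm x y :
  shift_poly x = shift_poly y <-> exists p : 'S_k, forall i, y i = x (p i).
Proof.
split=> [eq_xy | [p def_y]]; last first.
  rewrite /shift_poly [LHS](reindex_inj (@perm_inj _ p)) /=.
  by apply: eq_bigr => i _; rewrite def_y.
(* Unique factorization is applied over the field of rationals. *)
pose neg (v : 'I_N.+1) : rat := (- (v : nat)%:Z)%:~R.
have neg_inj : injective neg by move=> u v /intr_inj/oppr_inj [] /val_inj.
have prod_neg (z : box) : \prod_(c <- map neg [tuple z i | i < k]) ('X - c%:P) =
    map_poly (intr : int -> rat) (shift_poly z).
  by rewrite shift_polyE map_prod_XsubC /= -map_comp big_map big_enum.
have : perm_eq (map neg [tuple y i | i < k]) (map neg [tuple x i | i < k]).
  by apply: prod_XsubC_eq; rewrite !prod_neg eq_xy.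
move=> /(perm_map_inj neg_inj)/tuple_permP[p /val_inj def_y].
exists p => i; have := congr1 (fun t => tnth t i) def_y.
by rewrite !tnth_mktuple.
Qed.

Lemma card_box_roots tau : tau != 0 -> (size tau <= k.+1)%N ->
  (#|[pred x : box | [forall i, root tau (- (x i : nat)%:Z)]]| <= k ^ k)%N.
Proof.
move=> tau_neq0 sz_tau; pose r := [pred v : 'I_N.+1 | root tau (- (v : nat)%:Z)].
have r_le : (#|r| <= k)%N.
  rewrite cardE -(size_map (fun v : 'I_N.+1 => - (v : nat)%:Z)) -ltnS.
  apply: leq_trans sz_tau; apply: max_poly_roots => //.
    by apply/allP => _ /mapP[v v_r ->]; rewrite mem_enum in v_r.
  rewrite map_inj_uniq ?enum_uniq // => u v /oppr_inj[]; exact: val_inj.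
rewrite (@eq_card _ _ (ffun_on r)) ?card_ffun_on ?card_ord => [|x].
  by case: (k) r_le => // k' r_le; rewrite leq_exp2r.
by rewrite [LHS]inE; apply/forallP/ffun_onP => h i; apply: h.
Qed.

(** All such points have their entries among the roots of tau. *)
Lemma card_shift_poly_eq tau : (#|[pred x : box | shift_poly x == tau]| <= k ^ k)%N.
Proof.
have [x0 /eqP x0_tau | none] := pickP [pred x : box | shift_poly x == tau]; last first.
  by rewrite (eq_card none) card0.
apply: leq_trans (card_box_roots tau _ _).
- apply/subset_leq_card/fintype.subsetP => y /eqP <-; rewrite inE.
  by apply/forallP => i; exact: root_shift_poly.
- by rewrite -x0_tau -size_poly_gt0 size_shift_poly.
- by rewrite -x0_tau size_shift_poly.
Qed.

Lemma card_box_divisors (v : 'I_N.+1) (M : int) : M != 0 ->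
  (#|[pred x : box | [forall j, ((x j : nat)%:Z - (v : nat)%:Z %| M)%Z]]|
     <= (2 * size (divisors `|M|%N)) ^ k)%N.
Proof.
move=> M_neq0.
pose r := [pred u : 'I_N.+1 | ((u : nat)%:Z - (v : nat)%:Z %| M)%Z].
have r_le : (#|r| <= 2 * size (divisors `|M|%N))%N.
  pose f (u : 'I_N.+1) := ((u <= v)%N, `|(u : nat)%:Z - (v : nat)%:Z|%N).
  rewrite cardE -(size_map f).
  rewrite -[2%N]/(size [:: true; false]) -(size_allpairs pair).
  apply: uniq_leq_size => [|_ /mapP[u u_r ->]].
    rewrite map_inj_uniq ?enum_uniq // => u w [le_uw abs_uw].
    by apply: val_inj => /=; lia.
  apply: allpairs_f; first by case: (_ <= _)%N.
  by rewrite -dvdn_divisors ?absz_gt0 //; rewrite mem_enum in u_r.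
rewrite (@eq_card _ _ (ffun_on r)) ?card_ffun_on ?card_ord => [|x].
  by case: (k) => // k'; rewrite leq_exp2r.
by rewrite [LHS]inE; apply/forallP/ffun_onP => h i; apply: h.
Qed.

(** Here B bounds the number of divisors of the integers up to N ^ k. The pairs
are sorted by an index i such that tau does not vanish at - y_i, if there is
one: the value y_i and then the point x can be chosen first, the differences
x_j - y_i being divisors of tau(- y_i). Without such an index it is y that can
be chosen first, among the roots of tau. *)
Lemma card_shift_poly_diff tau (B : nat) : tau != 0 -> (0 < k)%N -> (0 < N)%N ->
  (forall n, (0 < n <= N ^ k)%N -> (size (divisors n) <= B)%N) ->
  (#|[pred xy : box * box |
       (shift_poly xy.1 - shift_poly xy.2)%R == tau]|
    <= k.+1 * (N.+1 * ((2 * k * B) ^ k * k ^ k)))%N.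
Proof.
move=> tau_neq0 k_gt0 N_gt0 div_le; set S := [pred _ | _].
have B_gt0 : (0 < B)%N by apply: leq_trans (div_le 1%N _); rewrite // expn_gt0 N_gt0.
have inj1 : injective (fun xy : box * box => (xy.1, xy.2)).
  by move=> [x y] [x' y'].
have inj2 : injective (fun xy : box * box => (xy.2, xy.1)).
  by move=> [x y] [x' y'] /= [-> ->].
pose f (xy : box * box) :=
  [pick i | ~~ root tau (- (xy.2 i : nat)%:Z)].
rewrite -(_ : #|(predT : pred (option 'I_k))| = k.+1); last first.
  by rewrite card_option card_ord.
apply: (@card_le_fibers _ _ S f predT) => // -[i|] _; last first.
  (* Every - y_i is a root of tau. *)
  set S' := [pred _ | _].
  have [[x0 y0] /andP[/eqP xy0 _] | none] := pickP S'; last by rewrite (eq_card none) card0.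
  apply: leq_trans (_ : k ^ k * k ^ k <= _)%N; last first.
    apply: leq_trans (leq_pmull _ _) => //; rewrite leq_mul2r leq_exp2r //.
    by rewrite mulnAC -[X in (X <= _)%N]mul1n leq_mul2r muln_gt0 B_gt0 !orbT.
  apply: leq_trans (@card_le_pairs _ _ _ S' snd fst
    [pred y : box | [forall i, root tau (- (y i : nat)%:Z)]]
    (fun y => [pred x : box | shift_poly x == shift_poly y + tau]) _ inj2 _ _ _) _.
  - move=> [x y] /andP[_]; rewrite /f inE; case: pickP => // no_i _.
    by apply/forallP => i; apply: negbFE (no_i i).
  - by move=> [x y] /andP[/eqP <- _]; rewrite inE addrC subrK.
  - by move=> y _; exact: card_shift_poly_eq.
  rewrite leq_mul2r card_box_roots ?orbT //.
  rewrite -xy0; apply: leq_trans (size_polyD _ _) _.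
  by rewrite size_polyN !size_shift_poly maxnn.
rewrite -[X in (_ <= X * _)%N](_ : #|(predT : pred 'I_N.+1)| = N.+1); last first.
  by rewrite card_ord.
apply: (@card_le_fibers _ _ [pred s in S | f s == Some i] (fun xy => xy.2 i) predT) => // v _.
set S' := [pred _ | _].
(* A pair in the fibre ensures that tau(- v) is nonzero and at most N ^ k. *)
have [[x0 y0] /andP[/andP[/eqP xy0 f_xy0] /eqP y0v] | none] := pickP S';
  last by rewrite (eq_card none) card0.
have tau_v x y : shift_poly x - shift_poly y = tau -> y i = v ->
    tau.[- (v : nat)%:Z] = \prod_(j < k) ((x j : nat)%:Z - (v : nat)%:Z).
  move=> <- <-; rewrite hornerD hornerN (eqP (root_shift_poly y i)) subr0.
  exact: horner_shift_poly.
have tau_v_neq0 : tau.[- (v : nat)%:Z] != 0.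
  move: f_xy0; rewrite /f; case: pickP => // i' nroot /eqP [eq_i].
  by rewrite -y0v -eq_i; exact: nroot.
have tau_v_le : (`|tau.[- (v : nat)%:Z]|%N <= N ^ k)%N.
  rewrite (tau_v _ _ xy0 y0v) (big_morph absz abszM absz1).
  rewrite -[k in (N ^ k)%N]card_ord -prod_nat_const; apply: leq_prod => j _.
  move: (ltn_ord (x0 j)) (ltn_ord v); rewrite /= !ltnS.
  by move: (nat_of_ord _) (nat_of_ord _) => a b; lia.
apply: leq_trans (@card_le_pairs _ _ _ S' fst snd
    [pred x : box | [forall j, ((x j : nat)%:Z - (v : nat)%:Z %| tau.[- (v : nat)%:Z])%Z]]
    (fun x => [pred y : box | shift_poly y == shift_poly x - tau]) _ inj1 _ _ _) _.
- move=> [x y] /andP[/andP[/eqP xy_tau _] /eqP yv]; rewrite inE.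
  apply/forallP => j; rewrite (tau_v _ _ xy_tau yv) (bigD1 j) //=.
  by rewrite dvdz_mulr.
- by move=> [x y] /andP[/andP[/eqP <- _] _]; rewrite inE opprB addrC subrK.
- by move=> x _; exact: card_shift_poly_eq.
rewrite leq_mul2r; apply/orP; right.
apply: leq_trans (card_box_divisors _ _ tau_v_neq0) _.
rewrite leq_exp2r // mulnAC; apply: leq_trans (leq_pmulr _ k_gt0).
by rewrite leq_mul2l /= div_le // tau_v_le absz_gt0 tau_v_neq0.
Qed.
End Box.

(** * Non-diagonal solutions *)

Lemma sigmaE (k j : nat) (z : 'I_k -> int) :
  sigma j z = \sum_(A : {set 'I_k} | #|A| == j) \prod_(i in A) z i.
Proof.
rewrite /sigma mpoly.mesymE (raddf_sum (mpoly.meval z)) /=.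
apply: eq_bigr => A _; rewrite mpoly.mevalX [RHS]big_mkcond /=.
by apply: eq_bigr => i _; rewrite mpoly.mnmE; case: (i \in A).
Qed.

Local Notation int_pt x := (fun i => ((x i : nat)%:Z : int)).

Section Sol.
Variables k N : nat.
Notation box := {ffun 'I_k -> 'I_N.+1}.
Implicit Types x y : box.

Lemma sigma_ge0 j x : 0 <= sigma j (int_pt x).
Proof. by rewrite sigmaE; apply: sumr_ge0 => A _; apply: prodr_ge0. Qed.

Lemma sigma_le j x : sigma j (int_pt x) <= (2 ^ k * N ^ j)%N%:Z.
Proof.
rewrite sigmaE; apply: (@le_trans _ _ (\sum_(A : {set 'I_k}) (N ^ j)%N%:Z)).
  rewrite big_mkcond; apply: ler_sum => A _; case: eqP => // <-.
  rewrite -prod_nat_const (big_morph Posz PoszM (erefl (1 : int))); apply: ler_prod => i _.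
  by apply/andP; split=> //; rewrite lez_nat -ltnS ltn_ord.
by rewrite sumr_const -cardsT -powersetT card_powerset cardsT card_ord -mulr_natl PoszM natz.
Qed.

Lemma shift_poly_sigma x :
  shift_poly x = \sum_(j < k.+1) (sigma j (int_pt x))%:P * 'X^(k - j).
Proof. by rewrite sigma_gen. Qed.

Lemma sigma0 (z : 'I_k -> int) : sigma 0 z = 1.
Proof. by rewrite /sigma mpoly.mesym0E (rmorph1 (mpoly.meval z)). Qed.

Definition solves (r : nat) (a : nat -> nat -> int) x y : bool :=
  [forall j : 'I_k.+1, (k - r + 1 <= j)%N ==>
     (Defs.form r a j (int_pt x) == Defs.form r a j (int_pt y))].

(** The equations give every sigma_j(x) - sigma_j(y) with j > k - r as a fixed
integral combination of the differences of index at most k - r. *)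
Lemma solves_shift_poly_diff r a x y x' y' :
  solves r a x y -> solves r a x' y' ->
  (forall l, (0 < l <= k - r)%N ->
     sigma l (int_pt x) - sigma l (int_pt y) =
     sigma l (int_pt x') - sigma l (int_pt y')) ->
  shift_poly x - shift_poly y = shift_poly x' - shift_poly y'.
Proof.
move=> /forallP sol /forallP sol' eq_low.
rewrite !shift_poly_sigma -!sumrB; apply: eq_bigr => j _.
rewrite -!mulrBl -!polyCB; congr (_%:P * _).
have [-> | j_gt0] := posnP j; first by rewrite !sigma0 !subrr.
have [j_le | j_gt] := leqP j (k - r); first by rewrite eq_low ?j_gt0.
have high (u v : box) : (k - r + 1 <= j)%N ==>
     (Defs.form r a j (int_pt u) == Defs.form r a j (int_pt v)) ->
  sigma j (int_pt u) - sigma j (int_pt v) =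
  - \sum_(1 <= l < (k - r).+1) a j l * (sigma l (int_pt u) - sigma l (int_pt v)).
  rewrite addn1 j_gt /Defs.form => /eqP; move: (sigma j _) (sigma j _) => s t.
  under [\sum_(1 <= l < _) a j l * (_ - _)]eq_bigr do rewrite mulrBr.
  rewrite sumrB opprB => eq_st; apply/eqP.
  by rewrite subr_eq addrAC eq_sym subr_eq eq_st addrC.
rewrite (high _ _ (sol j)) (high _ _ (sol' j)); congr (- _).
by apply: eq_big_nat => l l_in; rewrite eq_low // -ltnS.
Qed.

(** Only an upper bound for the number of these pairs is of interest, so the
entry 0 is allowed; by [shift_poly_perm] the second condition says that x and y
are not permutations of each other. *)
Definition nondiag r a : pred (box * box) :=
  [pred xy | solves r a xy.1 xy.2 & shift_poly xy.1 != shift_poly xy.2].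

(** The polynomial P_x - P_y of a solution is encoded by k - r integers, the l-th
being sigma_l(x) - sigma_l(y) shifted to the range from 0 to 2 ^ k.+1 * N ^ l;
the exponent 'C((k - r).+1, 2) is the sum of the l up to k - r. *)
Lemma card_nondiag r a B : (0 < k)%N -> (0 < N)%N ->
  (forall n, (0 < n <= N ^ k)%N -> (size (divisors n) <= B)%N) ->
  (#|nondiag r a| <=
     (2 ^ (k + 2)) ^ (k - r) * N ^ 'C((k - r).+1, 2) *
     (k.+1 * (N.+1 * ((2 * k * B) ^ k * k ^ k))))%N.
Proof.
move=> k_gt0 N_gt0 div_le; pose d := (k - r)%N; pose c l := (2 ^ k * N ^ l)%N.
pose code l (xy : box * box) :=
  absz (sigma l (int_pt xy.1) - sigma l (int_pt xy.2) + (c l)%:Z).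
have code_le l xy : (code l xy <= 2 * c l)%N.
  rewrite /code; have := sigma_ge0 l xy.1; have := sigma_ge0 l xy.2.
  by have := sigma_le l xy.1; have := sigma_le l xy.2; rewrite -/(c l); lia.
have c_mono l : (l <= d)%N -> (c l <= c d)%N.
  by move=> le_ld; rewrite leq_mul2l leq_pexp2l // orbT.
pose f xy : {ffun 'I_d -> 'I_(2 * c d).+1} := [ffun l : 'I_d => inord (code l.+1 xy)].
have fE xy (l : 'I_d) : f xy l = code l.+1 xy :> nat.
  rewrite ffunE inordK // ltnS; apply: leq_trans (code_le _ _) _.
  by rewrite leq_mul2l c_mono.
pose F (l : 'I_d) := [pred u : 'I_(2 * c d).+1 | u <= 2 * c l.+1]%N.
have cardF : (#|family F| <= (2 ^ (k + 2)) ^ d * N ^ 'C(d.+1, 2))%N.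
  have cardFl (l : 'I_d) : (#|F l| <= 2 ^ (k + 2) * N ^ l.+1)%N.
    apply: (@leq_trans (2 * c l.+1).+1).
      rewrite cardE -(size_map val) -[X in (_ <= X)%N](size_iota 0).
      apply: uniq_leq_size; first by rewrite map_inj_uniq ?enum_uniq //; apply: val_inj.
      by move=> _ /mapP[u u_in ->]; rewrite mem_enum inE in u_in; rewrite mem_iota.
    rewrite /c expnD; have : (0 < 2 ^ k * N ^ l.+1)%N by rewrite muln_gt0 !expn_gt0 N_gt0.
    by rewrite mulnAC; lia.
  rewrite card_family foldrE big_map big_enum /=.
  apply: leq_trans (leq_prod (fun l _ => cardFl l)) _.
  rewrite big_split /= prod_nat_const card_ord leq_mul2l.
  by rewrite -expn_sum -bin2_sum big_nat_recl // add0n big_mkord leqnn orbT.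
apply: leq_trans (leq_mul cardF (leqnn _)).
apply: (@card_le_fibers _ _ _ f) => [xy _ | u _].
  by apply/familyP => l; rewrite inE fE code_le.
set S := [pred _ | _].
have [[x0 y0] /andP[/andP[sol0 neq0] /eqP f0] | none] := pickP S; last first.
  by rewrite (eq_card none) card0.
have tau_neq0 : shift_poly x0 - shift_poly y0 != 0 by rewrite subr_eq0.
apply: leq_trans (card_shift_poly_diff _ _ _ B tau_neq0 k_gt0 N_gt0 div_le).
apply/subset_leq_card/fintype.subsetP => -[x y] /andP[/andP[/= sol _] /eqP fxy].
rewrite inE /=; apply/eqP; apply: solves_shift_poly_diff sol sol0 _ => l /andP[].
case: l => // l _ l_lt.
have := fE (x, y) (Ordinal l_lt); rewrite fxy -f0 fE /code /=.
have := sigma_ge0 l.+1 x; have := sigma_ge0 l.+1 y.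
have := sigma_le l.+1 x; have := sigma_le l.+1 y.
have := sigma_ge0 l.+1 x0; have := sigma_ge0 l.+1 y0.
have := sigma_le l.+1 x0; have := sigma_le l.+1 y0.
rewrite -/(c _); lia.
Qed.
End Sol.

(** Raising to the power m expresses, inside nat, that the number of non-diagonal
solutions is O(N ^ ('C((k - r).+1, 2).+1 + 1 / m)). The points being restricted
by a k-th power of the divisor bound for integers up to N ^ k, the latter is
needed with the exponent k * k * m. *)
Lemma card_nondiag_expn (k r : nat) a m : (0 < k)%N -> (0 < m)%N ->
  exists C : nat, forall N : nat, (0 < N)%N ->
    (#|nondiag k N r a| ^ m <= C * N ^ ('C((k - r).+1, 2).+1 * m + 1))%N.
Proof.
move=> k_gt0 m_gt0; pose C1 := (((k * k * m) ^ (k * k * m)) ^ (2 ^ (k * k * m)))%N.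
pose C2 := ((2 ^ (k + 2)) ^ (k - r) * (k.+1 * (2 * ((2 * k) ^ k * k ^ k))))%N.
exists (C2 ^ m * C1)%N => N N_gt0.
pose B := \max_(n < (N ^ k).+1) size (divisors n).
have div_le n : (0 < n <= N ^ k)%N -> (size (divisors n) <= B)%N.
  by move=> /andP[_ n_le]; exact: (leq_bigmax (Ordinal (n_le : n < (N ^ k).+1)%N)).
have B_le : (B ^ (k * m) <= C1 * N)%N.
  have [n0 B_n0] : {n0 : 'I_(N ^ k).+1 | B = size (divisors n0)}.
    by apply: bigop.eq_bigmax; rewrite card_ord.
  rewrite -(leq_exp2r _ _ k_gt0) -expnM expnMn.
  apply: (@leq_trans (C1 * N ^ k)); last first.
    rewrite leq_mul2r -[X in (X <= _)%N]expn1 leq_pexp2l ?orbT //.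
    by rewrite /C1 !expn_gt0 !muln_gt0 k_gt0 m_gt0.
  rewrite B_n0; have [n0_0 | n0_gt0] := posnP n0.
    by rewrite n0_0 exp1n muln_gt0 !expn_gt0 N_gt0 !muln_gt0 k_gt0 m_gt0.
  have -> : (k * m * k = k * k * m)%N by rewrite mulnAC.
  apply: leq_trans (size_divisors_expn_le _ _ _ n0_gt0) _; rewrite ?muln_gt0 ?k_gt0 //.
  by rewrite leq_mul2l -[X in _ || X]ltnS ltn_ord orbT.
have card_le : (#|nondiag k N r a| <= C2 * (N ^ 'C((k - r).+1, 2).+1 * B ^ k))%N.
  apply: leq_trans (card_nondiag k N r a B k_gt0 N_gt0 div_le) _.
  have N1_le : (N.+1 <= 2 * N)%N by lia.
  rewrite /C2 expnS [((2 * k * B) ^ k)%N]expnMn.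
  move: (2 ^ (k + 2))%N (N ^ 'C(_, _))%N ((2 * k) ^ k)%N (k ^ k)%N (B ^ k)%N => e D u v w.
  apply: (@leq_trans (e ^ (k - r) * D * (k.+1 * ((2 * N) * (u * w * v))))).
    by rewrite !leq_mul.
  by apply: eq_leq; move: (e ^ _)%N => e'; lia.
clearbody C1 C2; move: card_le; rewrite -(leq_exp2r _ _ m_gt0) => /leq_trans; apply.
rewrite !expnMn -!expnM expnD expn1 -mulnA leq_mul2l; apply/orP; right.
by rewrite mulnCA leq_mul2l B_le orbT.
Qed.

(** * Comparison with the diagonal solutions and asymptotics *)

Lemma coef_shift_poly {k N : nat} (x : {ffun 'I_k -> 'I_N.+1}) (j : nat) :
  (j <= k)%N -> (shift_poly x)`_(k - j) = sigma j (int_pt x).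
Proof.
move=> j_le; rewrite shift_poly_sigma coef_sum.
rewrite (bigD1 (Ordinal (j_le : j < k.+1)%N)) //= coefCM coefXn eqxx mulr1.
rewrite big1 ?addr0 // => i; rewrite -val_eqE /= => i_neq.
rewrite coefCM coefXn; have := ltn_ord i; rewrite ltnS => i_le.
by case: eqP => [|_]; rewrite ?mulr0 //; move/eqP: i_neq; lia.
Qed.

Lemma Mkr_bounds (R : realType) (k r : nat) (a : nat -> nat -> int) (X : R) :
  (Tk k X <= Mkr k r a X <= Tk k X + #|nondiag k (Num.truncn X) r a|)%N.
Proof.
have diagP (x y : {ffun 'I_k -> 'I_(Num.truncn X).+1}) :
    [exists p : 'S_k, [forall i, y i == x (p i)]] = (shift_poly x == shift_poly y).
  apply/existsP/eqP => [[p /forallP def_y] | /shift_poly_perm[p def_y]].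
    by apply/shift_poly_perm; exists p => i; apply/eqP.
  by exists p; apply/forallP => i; apply/eqP.
have diag_solves (x y : {ffun 'I_k -> 'I_(Num.truncn X).+1}) :
    shift_poly x = shift_poly y -> solves _ _ r a x y.
  move=> eq_xy; apply/forallP => j; apply/implyP => _.
  have eq_sigma i : (i <= k)%N -> sigma i (int_pt x) = sigma i (int_pt y).
    by move=> i_le; rewrite -!coef_shift_poly // eq_xy.
  have j_le : (j <= k)%N by rewrite -ltnS.
  rewrite /Defs.form eq_sigma //; apply/eqP; congr (_ + _).
  apply: eq_big_nat => l /andP[_ l_lt]; rewrite eq_sigma //.
  by apply: leq_trans (leq_subr r k); rewrite -ltnS.
rewrite /Tk /Mkr; apply/andP; split.
  apply/subset_leq_card/fintype.subsetP => -[x y]; rewrite !inE /= diagP.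
  by move=> /and3P[-> -> /eqP/diag_solves].
rewrite -cardUI; apply: leq_trans (leq_addr _ _).
apply/subset_leq_card/fintype.subsetP => -[x y]; rewrite !inE /= diagP.
move=> /and3P[-> -> sol] /=; case: eqP => //= _.
by rewrite andbT.
Qed.

(** The pairs (x, x) already give this many diagonal solutions. *)
Lemma expn_le_Tk (R : realType) (k : nat) (X : R) : (Num.truncn X ^ k <= Tk k X)%N.
Proof.
set N := Num.truncn X; rewrite /Tk; pose pos := [pred v : 'I_N.+1 | (1 <= v)%N].
have card_pos : #|pos| = N.
  rewrite (@eq_card _ _ (predC1 ord0)) ?cardC1 ?card_ord // => v.
  by rewrite !inE -lt0n.
rewrite -{1}card_pos -[k in (_ ^ k)%N]card_ord -card_ffun_on.
pose f (x : {ffun 'I_k -> 'I_N.+1}) := (x, x).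
have f_inj : injective f by move=> x y [].
rewrite -(fintype.card_image f_inj); apply/subset_leq_card/fintype.subsetP.
move=> _ /fintype.imageP[x /ffun_onP x_pos ->].
rewrite inE /= /in_box; apply/and3P; split; first exact/forallP.
  exact/forallP.
by apply/existsP; exists 1%g; apply/forallP => i; rewrite perm1.
Qed.

Lemma card_nondiag_powR (R : realType) (k r : nat) (a : nat -> nat -> int)
    (eps : R) : (0 < k)%N -> 0 < eps ->
  exists2 C : R, 0 < C & forall X : R, 1 <= X ->
    (#|nondiag k (Num.truncn X) r a|)%:R <= C * X `^ ('C((k - r).+1, 2).+1%:R + eps).
Proof.
move=> k_gt0 eps_gt0; set E := 'C(_, _).+1.
pose m := (Num.truncn eps^-1).+1.
have [C0 C0_le] := card_nondiag_expn k r a m k_gt0 isT.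
have m_gt0 : 0 < m%:R :> R by rewrite ltr0n.
have m_eps : m%:R^-1 <= eps.
  by rewrite invf_ple ?posrE //; apply/ltW/truncnS_gt.
exists (C0.+1%:R `^ m%:R^-1); first exact: powR_gt0.
move=> X X_ge1; have X_gt0 : 0 < X := lt_le_trans ltr01 X_ge1.
set N := Num.truncn X; have N_gt0 : (0 < N)%N by rewrite truncn_gt0.
have N_le : N%:R <= X by rewrite truncn_le ltW.
have n_le := C0_le N N_gt0; set n := #|_| in n_le *.
have -> : n%:R = ((n ^ m)%N%:R : R) `^ m%:R^-1.
  by rewrite natrX -powR_mulrn // -powRrM divff ?lt0r_neq0 // powRr1.
apply: (@le_trans _ _ ((C0.+1%:R * X ^+ (E * m + 1)) `^ m%:R^-1)).
  apply: ge0_ler_powR; rewrite ?nnegrE ?invr_ge0 ?ler0n // ?mulr_ge0 ?exprn_ge0 ?(ltW X_gt0) //.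
  apply: (@le_trans _ _ (C0 * N ^ (E * m + 1))%N%:R); first by rewrite ler_nat.
  rewrite natrM natrX ler_pM ?ler0n ?exprn_ge0 ?ler_nat //.
  by rewrite lerXn2r ?nnegrE ?(ltW X_gt0).
rewrite powRM ?exprn_ge0 ?(ltW X_gt0) // ler_pM2l ?powR_gt0 //.
rewrite -powR_mulrn ?(ltW X_gt0) // -powRrM ler_powR //.
by rewrite natrD natrM mulrDl mulfK ?lt0r_neq0 // mul1r lerD2l.
Qed.

Theorem corollary1p2 (R : realType) (k r : nat) (a : nat -> nat -> int)
    (k_gt0 : (0 < k)%N) (r_gt0 : (0 < r)%N) (r_le_k : (r <= k)%N)
    (hkr : ((k - r) * (k - r + 1) < 2 * k - 2)%N) :
  ((fun X : R => (Mkr k r a X)%:R : R) =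
     (fun X : R => (Tk k X)%:R : R) +o_ +oo
     (fun X : R => (Tk k X)%:R : R)) /\
  (forall eps : R, 0 < eps ->
     (fun X : R => (Mkr k r a X)%:R : R) =
       (fun X : R => (Tk k X)%:R : R) +O_ +oo
       (fun X : R => X `^ (2^-1 * ((k - r) * (k - r + 1))%:R + 1 + eps) : R)).
Proof.
have bin_half : (2 * 'C((k - r).+1, 2) = (k - r) * (k - r + 1))%N.
  elim: (k - r)%N => // d IHd; rewrite binS bin1 mulnDr IHd; lia.
have diff_le (X : R) : `|(Mkr k r a X)%:R - (Tk k X)%:R| <=
    (#|nondiag k (Num.truncn X) r a|)%:R :> R.
  have /andP[T_le M_le] := Mkr_bounds R k r a X.
  by rewrite -natrB // normr_nat ler_nat leq_subLR.
split => [|eps eps_gt0].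
  (* As 'C((k - r).+1, 2).+1 <= k - 1, the choice eps = 1 / 2 gives the bound
     O(X ^ (k - 1 / 2)), to be compared with Tk k X >= (X / 2) ^ k. *)
  apply/eqaddoP => e e_gt0.
  have [|C C_gt0 C_le] := card_nondiag_powR R k r a 2^-1 k_gt0; first by rewrite invr_gt0.
  near=> X.
  have X_ge1 : 1 <= X by near: X; apply: nbhs_pinfty_ge.
  have X_gt0 : 0 < X := lt_le_trans ltr01 X_ge1.
  apply: le_trans (diff_le X) _; apply: le_trans (C_le X X_ge1) _.
  apply: (@le_trans _ _ (C * X `^ (k%:R - 2^-1))).
    rewrite ler_pM2l // ler_powR //.
    have : 'C((k - r).+1, 2).+1%:R + 1 <= k%:R :> R by rewrite natr1 ler_nat; lia.
    lra.
  rewrite ger0_norm //; apply: (@le_trans _ _ (e * (2^-1 * X) ^+ k)); last first.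
    rewrite ler_pM2l //; apply: le_trans (_ : (Num.truncn X ^ k)%N%:R <= _); last first.
      by rewrite ler_nat expn_le_Tk.
    have N_gt0 : (0 < Num.truncn X)%N by rewrite truncn_gt0.
    rewrite natrX lerXn2r ?nnegrE ?mulr_ge0 ?(ltW X_gt0) //.
    rewrite ler_pdivrMl // -natrM; apply/ltW/(lt_le_trans (truncnS_gt X)).
    by rewrite ler_nat mul2n -addnn -[X in (X < _)%N]addn0 ltn_add2l.
  have -> : e * (2^-1 * X) ^+ k =
      X `^ (k%:R - 2^-1) * (e / 2 ^+ k * X `^ 2^-1).
    rewrite mulrCA -powRD ?subrK ?powR_mulrn ?(ltW X_gt0) //; last first.
      by rewrite (lt0r_neq0 X_gt0) implybT.
    by rewrite exprMn exprVn mulrA.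
  rewrite mulrC ler_pM2l ?powR_gt0 // -ler_pdivrMl ?divr_gt0 ?exprn_gt0 //.
  rewrite invf_div powR12_sqrt ?(ltW X_gt0) //.
  have c_ge0 : 0 <= 2 ^+ k / e * C.
    by rewrite mulr_ge0 ?divr_ge0 ?exprn_ge0 ?(ltW C_gt0) ?(ltW e_gt0).
  (* It remains to take X at least the square of the left-hand side. *)
  by rewrite -[leLHS]ger0_norm // -sqrtr_sqr ler_wsqrtr.
apply/eqaddOP.
have [C C_gt0 C_le] := card_nondiag_powR R k r a eps k_gt0 eps_gt0.
near=> c; near=> X.
have X_ge1 : 1 <= X by near: X; apply: nbhs_pinfty_ge.
apply: le_trans (diff_le X) _; apply: le_trans (C_le X X_ge1) _.
rewrite ger0_norm ?powR_ge0 //.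
have -> : 'C((k - r).+1, 2).+1%:R + eps =
    2^-1 * ((k - r) * (k - r + 1))%:R + 1 + eps :> R.
  by rewrite -bin_half natrM mulKf // -natr1.
by rewrite ler_wpM2r ?powR_ge0.
Unshelve. all: end_near.
Qed.
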